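(* Let $d\ge2$, $N,M\ge1$ be integers and $|\psi\rangle,|\phi\rangle\in\mathbb{C}^d$ unit vectors with $|\langle\psi|\phi\rangle|^2=c\in(0,1)$. The mean square error $v_{ep}(c)=\mathbb{E}\left[\left(\frac kN-c\right)^2\right]$ of the estimate-and-project strategy with estimator $\frac kN$ is $$v_{ep}(c)=\frac{c^2\,(dN+d^2N+M-2MN-M^2)+c\,(-2N-2dN-3M+dM+2MN+M^2)+d-1+2N+M}{N\,(d+M)(1+d+M)} .$$ Moreover $v_{ep}(c)\to\frac{c(1-c)}{N}$ as $M\to\infty$ with $N$ fixed, and $v_{ep}(c)\sim\frac{6c(1-c)}{M+N}$ as $M+N\to\infty$ with $M-N$ fixed.
   Context: Estimate-and-project strategy: first the covariant measurement is performed on $|\phi\rangle^{\otimes M}$, i.e. one obtains an estimate $|\phi_V\rangle=V|0\rangle$, $V\in SU(d)$, with probability density $\binom{M+d-1}{d-1}|\langle\phi_V|\phi\rangle|^{2M}$ with respect to the normalized Haar measure $dV$ ($|0\rangle$ a fixed unit vector). Then the projective measurement $\{|\phi_V\rangle\langle\phi_V|,\ \mathbb{1}-|\phi_V\rangle\langle\phi_V|\}$ is performed on each of the $N$ copies of $|\psi\rangle$, and $k$ is the number of successful projections on $|\phi_V\rangle$; thus, conditionally on $V$, $k$ is binomial with $N$ trials and success probability $|\langle\phi_V|\psi\rangle|^2$. *)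

(* Defs.v *)
From HB Require Import structures.
From mathcomp Require Import all_boot all_order all_algebra.
From mathcomp Require Import spectral complex.
From mathcomp Require Import all_classical all_reals all_analysis.

Set Implicit Arguments.
Unset Strict Implicit.
Unset Printing Implicit Defensive.

Import Order.TTheory GRing.Theory Num.Theory.
Import numFieldNormedType.Exports.

Local Open Scope classical_set_scope.
Local Open Scope ring_scope.
Local Open Scope complex_scope.
Local Open Scope sesquilinear_scope.

(* R[i] carries the topology of its modulus (that of its regular module
   R[i]^o); matrices over R[i] then carry the product topology. *)
HB.instance Definition _ (R : realType) := PseudoPointedMetric.copy R[i] R[i]^o.

Section kets.
Context {R : realType} {d : nat}.

(* <u|v>, conjugate-linear in u; kets are column vectors. *)
Definition braket (u v : 'cV[R[i]]_d) : R[i] := (u^t* *m v) 0 0.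

(* |<u|v>|^2, as an element of R. *)
Definition overlap (u v : 'cV[R[i]]_d) : R := ComplexField.Normc.normc (braket u v) ^+ 2.

Definition unit_ket (u : 'cV[R[i]]_d) : Prop := braket u u = 1.

End kets.

(* As a type, [SU R d] is the library's [set_type], with the topology induced
   by that of the matrices. *)
Definition SU (R : realType) (d : nat) : set 'M[R[i]]_d :=
  [set V | V \is unitarymx /\ \det V = 1].
Arguments SU : clear implicits.

Section special_unitary_group.
Context {R : realType} {d : nat}.

Lemma SU1 : (1%:M : 'M[R[i]]_d) \in SU R d.
Proof.
by rewrite inE; split; [apply/unitarymxP; rewrite trmx1 map_mx1 mulmx1|exact: det1].
Qed.

Lemma SUM (U V : SU R d) : \val U *m \val V \in SU R d.
Proof.
have [uU dU] := set_valP U; have [uV dV] := set_valP V.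
by rewrite inE; split; [exact: mul_unitarymx|rewrite det_mulmx dU dV mulr1].
Qed.

Definition su_one : SU R d := exist _ 1%:M SU1.

Definition su_mul (U V : SU R d) : SU R d := exist _ (\val U *m \val V) (SUM U V).

End special_unitary_group.

HB.instance Definition _ (R : realType) (d : nat) :=
  isPointed.Build (SU R d) (@su_one R d).

Definition borelSU (R : realType) (d : nat) :=
  g_sigma_algebraType (@open (SU R d)).

(* Normalization is part of the type [probability]; left invariance then
   characterizes the normalized Haar measure of the compact group SU(d). *)
Definition haar (R : realType) (d : nat) (mu : probability (borelSU R d) R) :=
  forall (U : SU R d) (A : set (borelSU R d)), measurable A ->
    mu [set V | A (su_mul U V)] = mu A.

Section estimate_and_project.
Context {R : realType} {d : nat}.
Variables (dV : probability (borelSU R d) R) (ket0 : 'cV[R[i]]_d).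
Variables (N M : nat) (psi phi : 'cV[R[i]]_d).

(* |phi_V> = V|0> *)
Definition estimate (V : SU R d) : 'cV[R[i]]_d := \val V *m ket0.

(* Density, with respect to dV, of the outcome of the covariant measurement
   on M copies of |phi>. *)
Definition covariant_density (V : SU R d) : R :=
  'C(M + d - 1, d - 1)%:R * overlap (estimate V) phi ^+ M.

(* Expectation of [f V k] under the joint law of the two outcomes: V has density
   [covariant_density] and, given V, k counts N independent projections that
   succeed with probability |<phi_V|psi>|^2. *)
Definition ep_expectation (f : SU R d -> nat -> \bar R) : \bar R :=
  (\int[dV]_V ((covariant_density V)%:E *
     \int[binomial_prob N (overlap (estimate V) psi)]_k f V k))%E.

Definition ep_mse (c : R) : \bar R :=
  ep_expectation (fun _ k => ((k%:R / N%:R - c) ^+ 2)%:E).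

End estimate_and_project.

(* Main.v *)
(* Haar invariance makes the moments of |<V 0|w>|^2 depend on w only through
   |w|^2:  E |<V 0|w>|^(2n) = mu_n |w|^(2n).  Taking w = phi + s psi and averaging
   over the phase of s leaves an identity between polynomials in |s|^2, whose
   coefficients of degree 1 and 2 give the mixed moments
   E |<V 0|phi>|^(2M) |<V 0|psi>|^(2k) for k = 1, 2.  Summing the k = 1 moments
   over an orthonormal basis yields a recursion for mu_n, hence
   mu_n = 1 / 'C(n + d - 1, d - 1).  The error of the binomial variable k / N given
   its success probability is a quadratic polynomial in that probability, so these
   moments suffice. *)

Require Import Defs.
From HB Require Import structures.
From mathcomp Require Import all_boot all_order all_algebra.
From mathcomp Require Import spectral complex.
From mathcomp Require Import separable cyclotomic ring.
From mathcomp Require Import all_classical all_reals all_analysis.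
From mathcomp Require Import measurable_realfun.

Set Implicit Arguments.
Unset Strict Implicit.
Unset Printing Implicit Defensive.

Import Order.TTheory GRing.Theory Num.Theory.
Import numFieldNormedType.Exports.

Local Open Scope classical_set_scope.
Local Open Scope ring_scope.
Local Open Scope complex_scope.

Local Notation normc := ComplexField.Normc.normc.

(** * Roots of unity and averaging over phases *)

Lemma sqr_normcE (R : realType) (z : R[i]) : (normc z ^+ 2)%:C = z * Num.conj z.
Proof. by rewrite -normCK rmorphXn. Qed.

Lemma conj_prim_root (F : numClosedFieldType) (L : nat) (w : F) :
  (0 < L)%N -> L.-primitive_root w -> Num.conj w = w^-1.
Proof.
move=> L0 wL; have w1 : `|w| = 1.
  by apply/eqP; rewrite -(@pexpr_eq1 _ _ L) // -normrX (prim_expr_order wL) normr1.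
by rewrite invC_norm w1 expr1n invr1 mul1r.
Qed.

(** In characteristic zero ['X^L - 1] is separable, so it has [L] distinct roots, and [L] distinct
    [L]-th roots of unity always include a primitive one. *)
Lemma prim_root_exists (F : numClosedFieldType) (L : nat) :
  (0 < L)%N -> exists w : F, L.-primitive_root w.
Proof.
move=> L0; have Lneq0 : L%:R != 0 :> F by rewrite pnatr_eq0 -lt0n.
have [rs Drs] := closed_field_poly_normal ('X^L - 1 : {poly F}).
rewrite lead_coefXnsubC // scale1r in Drs.
have : has L.-primitive_root rs.
  apply: cyclic.has_prim_root => //.
  - apply/allP => x xrs; rewrite unity_rootE.
    have : root (\prod_(z <- rs) ('X - z%:P)) x by rewrite root_prod_XsubC.
    by rewrite -Drs /root !hornerE subr_eq0.
  - by rewrite -separable_prod_XsubC -Drs separable_Xn_sub_1.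
  - by rewrite -ltnS -(size_prod_XsubC rs id) -Drs size_XnsubC.
by case/hasP => w _ wL; exists w.
Qed.

(** Orthogonality of the characters of the cyclic group of order [L]: off the diagonal the sum is
    geometric, with a ratio different from 1 whose [L]-th power is 1. *)
Lemma sum_prim_root (F : fieldType) (L : nat) (w : F) (k l : 'I_L) :
  L.-primitive_root w ->
  \sum_(j < L) (w ^+ j) ^+ k * (w ^- j) ^+ l = if k == l then L%:R else 0.
Proof.
move=> wL; have w0 : w != 0.
  by rewrite (prim_root_eq0 wL) -lt0n (leq_ltn_trans _ (ltn_ord k)).
have E (j : 'I_L) : (w ^+ j) ^+ k * (w ^- j) ^+ l = (w ^+ k / w ^+ l) ^+ j.
  by rewrite exprMn exprVn -!exprM exprVn -exprM mulnC (mulnC l).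
rewrite (eq_bigr _ (fun j _ => E j)); case: eqP => [->|/eqP kl].
  by under eq_bigr do rewrite divff ?expf_neq0 // expr1n; rewrite sumr_const card_ord.
have q1 : w ^+ k / w ^+ l - 1 != 0.
  rewrite subr_eq0 -(inj_eq (mulIf (expf_neq0 l w0))) divfK ?expf_neq0 // mul1r.
  by rewrite (eq_prim_root_expr wL) !modn_small.
apply: (mulfI q1); rewrite mulr0 -subrX1 exprMn exprVn -!exprM mulnC exprM.
by rewrite (prim_expr_order wL) mulnC exprM (prim_expr_order wL) !expr1n divr1 subrr.
Qed.

(* Averaging over the phases [w ^+ j] kills the off-diagonal terms of the double
   binomial expansion of [(x + w^j y)^n] times its conjugate. *)
Lemma phase_average (R : realType) (n L : nat) (w x y : R[i]) :
  (n < L)%N -> L.-primitive_root w ->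
  \sum_(j < L) (normc (x + w ^+ j * y) ^+ 2) ^+ n =
  L%:R * \sum_(k < n.+1)
    'C(n, k)%:R ^+ 2 * (normc x ^+ 2) ^+ (n - k) * (normc y ^+ 2) ^+ k.
Proof.
move=> nL wL; have L0 : (0 < L)%N by exact: leq_ltn_trans nL.
apply: (@complexI R); rewrite rmorph_sum rmorphM rmorph_nat rmorph_sum /=.
have cw : Num.conj w = w^-1 by exact: conj_prim_root wL.
pose cx := Num.conj x; pose cy := Num.conj y.
pose F (k l : 'I_n.+1) := (x ^+ (n - k) * y ^+ k * (cx ^+ (n - l) * cy ^+ l))
   *+ 'C(n, l) *+ 'C(n, k).
transitivity (\sum_(j < L) \sum_(k < n.+1) \sum_(l < n.+1)
    (w ^+ j) ^+ k * (w ^- j) ^+ l * F k l).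
  apply: eq_bigr => j _.
  rewrite rmorphXn /= sqr_normcE rmorphD rmorphM /= rmorphXn /= cw exprMn !exprDn.
  rewrite mulr_suml; apply: eq_bigr => k _.
  rewrite mulr_sumr; apply: eq_bigr => l _.
  rewrite /F !exprMn -/cx -/cy mulrnAl !mulrnAr; congr (_ *+ _ *+ _).
  by rewrite [w^-1 ^+ j]exprVn (mulrCA (x ^+ _)) (mulrCA (cx ^+ _)) mulrACA.
rewrite exchange_big mulr_sumr; apply: eq_bigr => k _.
rewrite exchange_big /=.
have S (l : 'I_n.+1) : \sum_(j < L) (w ^+ j) ^+ k * (w ^- j) ^+ l * F k l =
    if k == l then L%:R * F k k else 0.
  (* Both exponents are at most [n < L], so they label distinct characters unless they are equal. *)
  rewrite -mulr_suml (sum_prim_root (widen_ord nL k) (widen_ord nL l) wL).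
  by rewrite -val_eqE /= val_eqE; case: eqP => [->//|]; rewrite mul0r.
under eq_bigr => l _ do rewrite S.
rewrite -big_mkcond (big_pred1 k) => [|l]; last exact: eq_sym.
rewrite !rmorphM !rmorphXn /= !rmorph_nat.
have sqE (z : R[i]) : (normc z)%:C ^+ 2 = z * Num.conj z.
  by rewrite -sqr_normcE rmorphXn.
rewrite !sqE /F !exprMn -[X in _ * X]mulr_natr -[X in _ * (X * _)]mulr_natr.
by congr (_ * _); rewrite -mulrA mulrC (mulrACA (x ^+ _)) -[RHS]mulrA.
Qed.

(** * Inner products of kets and transitivity of SU(d) on unit kets *)

Section kets_theory.
Local Open Scope sesquilinear_scope.
Context {R : realType} {d : nat}.
Implicit Types (u v w : 'cV[R[i]]_d) (a : R[i]).

Lemma braketE u v : braket u v = \sum_i Num.conj (u i 0) * v i 0.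
Proof. by rewrite /braket mxE; apply: eq_bigr => i _; rewrite !mxE. Qed.

Lemma braketD u v w : braket u (v + w) = braket u v + braket u w.
Proof. by rewrite /braket mulmxDr mxE. Qed.

Lemma braketZ u a v : braket u (a *: v) = a * braket u v.
Proof. by rewrite /braket -scalemxAr mxE. Qed.

Lemma conj_braket u v : Num.conj (braket u v) = braket v u.
Proof.
rewrite !braketE rmorph_sum; apply: eq_bigr => i _.
by rewrite rmorphM /= conjCK mulrC.
Qed.

Lemma overlapE u v : (overlap u v)%:C = braket u v * Num.conj (braket u v).
Proof. exact: sqr_normcE. Qed.

Lemma overlapC u v : overlap u v = overlap v u.
Proof.
apply: (@complexI R); rewrite !overlapE -(conj_braket v u) conjCK mulrC.
by rewrite conj_braket.
Qed.

Lemma overlap_ge0 u v : 0 <= overlap u v.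
Proof. exact: sqr_ge0. Qed.

Lemma overlapZ u a v : overlap u (a *: v) = normc a ^+ 2 * overlap u v.
Proof. by rewrite /overlap braketZ ComplexField.Normc.normcM exprMn. Qed.

(** Parseval's identity in the standard basis. *)
Lemma overlap_sum u : (\sum_i overlap u (delta_mx i 0))%:C = braket u u.
Proof.
rewrite rmorph_sum braketE; apply: eq_bigr => i _ /=.
rewrite overlapE; have -> : braket u (delta_mx i 0) = Num.conj (u i 0).
  rewrite braketE (bigD1 i) //= big1 ?addr0 => [|j ji].
    by rewrite mxE !eqxx mulr1.
  by rewrite mxE (negbTE ji) mulr0.
by rewrite conjCK.
Qed.

Lemma braket_mul (A : 'M[R[i]]_d) u v : braket (A *m u) v = braket u (A^t* *m v).
Proof. by rewrite /braket trmx_mul map_mxM mulmxA. Qed.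

Lemma overlap_mul (A : 'M[R[i]]_d) u v : overlap (A *m u) v = overlap u (A^t* *m v).
Proof. by rewrite /overlap braket_mul. Qed.

Lemma unitary_unit_ket (A : 'M[R[i]]_d) u :
  A \is unitarymx -> unit_ket u -> unit_ket (A *m u).
Proof.
move=> uA uu; rewrite /unit_ket braket_mul mulmxA.
by rewrite -trmxC_unitary in uA; move/unitarymxP: uA; rewrite trmxCK => ->; rewrite mul1mx.
Qed.

Lemma unit_delta (i : 'I_d) : unit_ket (delta_mx i 0 : 'cV[R[i]]_d).
Proof.
rewrite /unit_ket braketE (bigD1 i) //= big1 ?addr0 => [|j ji].
  by rewrite mxE !eqxx conjC1 mulr1.
by rewrite mxE (negbTE ji) mulr0.
Qed.

Lemma overlap_delta (i j : 'I_d) : i != j ->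
  overlap (delta_mx i 0 : 'cV[R[i]]_d) (delta_mx j 0) = 0.
Proof.
move=> ij; rewrite /overlap braketE big1 ?ComplexField.Normc.normc0 ?expr0n // => k _.
rewrite !mxE; have [ki|ki] := eqVneq k i; last by rewrite conjC0 mul0r.
by rewrite ki (negbTE ij) mulr0.
Qed.

Lemma unit_ket_overlap u : unit_ket u -> overlap u u = 1.
Proof.
by move=> uu; apply: (@complexI R); rewrite overlapE uu conjC1 mulr1.
Qed.

Lemma unit_ket_sum u : unit_ket u -> \sum_i overlap u (delta_mx i 0) = 1.
Proof. by move=> uu; apply: (@complexI R); rewrite overlap_sum. Qed.

(* Gram-Schmidt on a matrix whose first row is [u^t*] leaves that row unchanged;
   rescaling another row then makes the determinant 1. *)
Lemma SU_delta (i0 i1 : 'I_d) u : i0 = 0 :> nat -> i0 != i1 -> unit_ket u ->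
  exists U : SU R d, (\val U)^t* *m u = delta_mx i0 0.
Proof.
move=> i00 i01 uu.
pose A : 'M[R[i]]_d := \matrix_i (if i == i0 then u^t* else 0).
pose S := schmidt A; have uS : S \is unitarymx by exact: schmidt_unitarymx.
have rA : row i0 A = u^t* by rewrite rowK eqxx.
have rS : row i0 S = u^t*.
  (* The index [i0] is the least one, so the span of the Gram-Schmidt rows up to [i0] is a single
     line. *)
  have /sub_rVP [a Da] : (row i0 A <= row i0 S)%MS.
    apply: (submx_trans (row_schmidt_sub A i0)).
    apply/sumsmx_subP => k; rewrite i00 leqn0 => /eqP k0.
    by rewrite (_ : k = i0) ?genmxE //; apply: val_inj; rewrite /= k0 i00.
  have s1 : dotmx (row i0 S) (row i0 S) = 1.
    by have /row_unitarymxP -> := uS; rewrite eqxx.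
  (* Gram-Schmidt is normalized so that [a] is nonnegative; both rows have norm 1, hence [a] is
     1. *)
  have := form1_row_schmidt A i0; rewrite -/S Da linearZl_LR /= s1 mulr1 => a0.
  have : dotmx (row i0 A) (row i0 A) = 1.
    by rewrite rA dotmxE trmxCK; exact: uu.
  rewrite Da linearZl_LR linearZr_LR /= s1 mulr1 -normCK => /eqP.
  rewrite sqrp_eq1 // ger0_norm // => /eqP a1.
  by rewrite -rA Da a1 scale1r.
have dS : \det S * Num.conj (\det S) = 1.
  move/unitarymxP: uS => /(congr1 determinant).
  by rewrite det_mulmx det_map_mx det_tr det1.
pose r : 'rV[R[i]]_d := \row_j (if j == i1 then Num.conj (\det S) else 1).
pose W := diag_mx r *m S.
have uD : diag_mx r \is unitarymx.
  apply/unitarymxP; rewrite tr_diag_mx map_diag_mx mulmx_diag -diag_const_mx.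
  congr diag_mx; apply/rowP => j; rewrite !mxE; case: ifP => _.
    by rewrite /= conjCK mulrC.
  by rewrite /= conjC1 mulr1.
have uW : W \is unitarymx by exact: mul_unitarymx.
have dW : \det W = 1.
  rewrite det_mulmx det_diag (bigD1 i1) //= big1 => [|j ji].
    by rewrite mxE eqxx mulr1 mulrC.
  by rewrite mxE (negbTE ji).
have rW : row i0 W = u^t*.
  rewrite -rS; apply/rowP => j; rewrite /W mul_diag_mx !mxE.
  by rewrite (negbTE i01) mul1r.
have uE : u = W^t* *m delta_mx i0 0.
  rewrite -[LHS]trmxCK -rW rowE trmx_mul map_mxM trmx_delta.
  by rewrite map_delta_mx.
have mW : W^t* \in SU R d.
  rewrite inE; split; first by rewrite trmxC_unitary.
  by rewrite det_map_mx det_tr dW /= conjC1.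
exists (exist (fun V => V \in SU R d) (W^t* ) mW); rewrite /= trmxCK uE mulmxA.
by move/unitarymxP: uW => ->; rewrite mul1mx.
Qed.

End kets_theory.

(** * Continuity and measurability of the overlap with the estimate *)

Lemma continuous_normc (R : realType) : continuous (fun z : R[i] => normc z).
Proof.
move=> z; apply/(@cvgrPdist_lt _ _ _ (nbhs z) (nbhs_filter z)) => e e0.
have : \forall y \near z, `|z - y| < e%:C.
  by apply: (@nbhsx_ballx _ R[i]^o z e%:C); rewrite ltcR.
apply: filterS => y; rewrite ltcR => zy.
apply: le_lt_trans zy.
(* One half of the reverse triangle inequality; the other half follows by symmetry. *)
have sub (a b : R[i]) : normc a - normc b <= normc (a - b).
  by rewrite lerBlDr -{1}(subrK b a) le_normcD.
by rewrite ler_norml sub andbT lerNl opprB -(opprB y) normcN sub.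
Qed.

Section overlap_measurable.
Context {R : realType} {d : nat} (ket0 w : 'cV[R[i]]_d).

Lemma continuous_overlap :
  continuous (fun V : SU R d => overlap (estimate ket0 V) w).
Proof.
(* Symmetry of the overlap puts the conjugation on the constant [w], which leaves a linear form in
   the entries of [V]. *)
pose f (V : SU R d) := \sum_i Num.conj (w i 0) * \sum_j \val V i j * ket0 j 0.
have -> : (fun V : SU R d => overlap (estimate ket0 V) w) =
    (fun V => normc (f V) ^+ 2).
  apply/funext => V; rewrite overlapC /overlap braketE; congr (normc _ ^+ 2).
  by apply: eq_bigr => i _; rewrite mxE.
have cf : continuous (f : SU R d -> R[i]).
  have addc : continuous (fun x : R[i]^o * R[i]^o => x.1 + x.2) := @add_continuous _.
  have c0 i j : continuous (fun V : SU R d => \val V i j : R[i]^o).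
    move=> V; apply: (@continuous_comp _ _ _ (\val : SU R d -> 'M[R[i]]_d)
      (fun M => M i j : R[i]^o)); first exact: initial_continuous.
    exact: coord_continuous.
  have c1 i : continuous (fun V : SU R d => \sum_j \val V i j * ket0 j 0 : R[i]^o).
    apply: (@continuous_big R[i]^o _ _ _ _ addc) => j _ V.
    by apply: (@cvgMr_tmp R[i] _ (nbhs V) (nbhs_filter V)); exact: c0.
  apply: (@continuous_big R[i]^o _ _ _ _ addc) => i _ V.
  by apply: (@cvgMl_tmp R[i] _ (nbhs V) (nbhs_filter V)); exact: c1.
move=> V; apply: (@continuous_comp _ _ _ (fun V => normc (f V)) (fun x => x ^+ 2)).
  apply: (@continuous_comp _ _ _ f (fun z => normc z)); [exact: cf|exact: continuous_normc].
exact: exprn_continuous.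
Qed.

Lemma measurable_overlap :
  measurable_fun [set: borelSU R d] (fun V => overlap (estimate ket0 V) w).
Proof.
apply: (measurability _ (measurable_realfun.RGenOpens.measurableE R)).
move=> _ [_ [a [b ->] <-]]; rewrite setTI; apply: sub_sigma_algebra.
by move/continuousP: continuous_overlap; apply; exact: interval_open.
Qed.

End overlap_measurable.

(** * Auxiliary facts on polynomials, finite sums and integrals *)

(** If nonzero, [p - q] would vanish at [size (p - q)] natural numbers, more roots than its degree
    allows. Averaging over phases yields identities in t = |s|^2, hence only for nonnegative t. *)
Lemma poly_eq_nneg (R : numDomainType) (p q : {poly R}) :
  (forall t, 0 <= t -> p.[t] = q.[t]) -> p = q.
Proof.
move=> pq; apply/eqP; rewrite -subr_eq0; apply: contraT => pq0.
pose rs : seq R := [seq i%:R | i <- iota 0 (size (p - q))].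
have rs_root : all (root (p - q)) rs.
  by apply/allP => _ /mapP [i _ ->]; rewrite /root !hornerE pq ?subrr.
have rs_uniq : uniq rs.
  by rewrite map_inj_uniq ?iota_uniq //; exact: (mulrIn (oner_neq0 R)).
have := max_poly_roots pq0 rs_root rs_uniq.
by rewrite size_map size_iota ltnn.
Qed.

(** Used to read off the coefficient of ['X^m] in a double sum of monomials ['X^(i + k)]; as
    [m <= n], the whole antidiagonal lies within the square. *)
Lemma sum_antidiagonal (A : pzSemiRingType) (n m : nat) (F : nat -> nat -> A) :
  (m <= n)%N ->
  \sum_(i < n.+1) \sum_(k < n.+1) F i k * (m == i + k)%N%:R =
  \sum_(i < m.+1) F i (m - i)%N.
Proof.
move=> mn; pose G i := if (i < m.+1)%N then F i (m - i)%N else 0.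
rewrite (eq_bigr (fun i : 'I_n.+1 => G i)) => [|i _].
  by rewrite -big_mkcond -(big_ord_widen n.+1 (fun i => F i (m - i)%N)).
rewrite /G ltnS; case: leqP => im; last first.
  apply: big1 => k _; rewrite (_ : (m == i + k)%N = false) ?mulr0 //.
  by rewrite ltn_eqF // ltn_addr.
have mi : (m - i < n.+1)%N by rewrite ltnS (leq_trans (leq_subr _ _)).
rewrite (bigD1 (Ordinal mi)) //= subnKC // eqxx mulr1 big1 ?addr0 // => k.
rewrite -val_eqE /= => ki; rewrite (_ : (m == i + k)%N = false) ?mulr0 //.
by apply: contraNF ki => /eqP ->; rewrite addKn.
Qed.

Lemma Rintegral_sum d (T : measurableType d) (R : realType)
    (mu : {measure set T -> \bar R}) (I : Type) (s : seq I) (f : I -> T -> R) :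
  (forall i, mu.-integrable setT (EFin \o f i)) ->
  \int[mu]_V (\sum_(i <- s) f i V) = \sum_(i <- s) \int[mu]_V f i V.
Proof.
move=> fi; elim: s => [|i s IHs].
  by rewrite big_nil; under eq_Rintegral do rewrite big_nil; rewrite Rintegral_cst // mul0r.
rewrite big_cons -IHs -RintegralD //.
  by apply: eq_Rintegral => V _; rewrite big_cons.
have := @integrable_sum _ _ _ mu setT measurableT _ s xpredT (fun i => EFin \o f i) (fun i _ => fi i).
by apply: eq_integrable => // V _ /=; rewrite sumEFin.
Qed.

Lemma integral_EFin d (T : measurableType d) (R : realType)
    (mu : {measure set T -> \bar R}) (g : T -> R) :
  mu.-integrable setT (EFin \o g) ->
  (\int[mu]_x (g x)%:E = (\int[mu]_x g x)%R%:E)%E.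
Proof. by move=> ig; rewrite fineK // integrable_fin_num. Qed.

(** * Squared norms *)

Section norm_squared.
Local Open Scope sesquilinear_scope.
Context {R : realType} {d : nat}.
Implicit Types (u v w : 'cV[R[i]]_d) (a : R[i]).

(** The squared norm <w|w>, written through the real-valued overlaps so that it lives in [R] rather
    than in [R[i]]. *)
Definition nsq w : R := \sum_i overlap w (delta_mx i 0).

Lemma nsqE w : (nsq w)%:C = braket w w.
Proof. exact: overlap_sum. Qed.

Lemma nsq_ge0 w : 0 <= nsq w.
Proof. by apply: sumr_ge0 => i _; exact: overlap_ge0. Qed.

(** An element of SU(d) turns [w] into a basis vector, and the overlap with it is one term of a sum
    of nonnegative terms equal to 1. *)
Lemma overlap_le1 (hd : (2 <= d)%N) u w :
  unit_ket u -> unit_ket w -> overlap u w <= 1.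
Proof.
move=> uu uw; pose i0 : 'I_d := Ordinal (ltnW hd); pose i1 : 'I_d := Ordinal hd.
have [U Uw] := @SU_delta _ _ i0 i1 w erefl isT uw.
have [uU _] := set_valP U.
rewrite -[w]mul1mx -(unitarymxP uU) -mulmxA Uw.
rewrite -[\val U]trmxCK -overlap_mul.
have u1 : unit_ket ((\val U)^t* *m u) by apply: unitary_unit_ket; rewrite ?trmxC_unitary.
rewrite -(unit_ket_sum u1) (bigD1 i0) //= lerDl sumr_ge0 // => i _.
exact: overlap_ge0.
Qed.

(** The norm is split so that the phase of [a] enters only through a term of the shape handled by
    [phase_average]. *)
Lemma nsqDZ u v a : unit_ket u -> unit_ket v ->
  nsq (u + a *: v) =
  normc (1 + a * braket u v) ^+ 2 + normc a ^+ 2 * (1 - overlap u v).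
Proof.
move=> uu uv; apply: (@complexI R).
rewrite nsqE rmorphD (rmorphM _ (normc a ^+ 2)) rmorphB rmorph1 /= !sqr_normcE.
rewrite braketD braketZ -[braket _ u]conj_braket -[braket _ v]conj_braket.
rewrite !braketD !braketZ uu uv !rmorphD !rmorphM /= !rmorph1 mulr1.
by rewrite (conj_braket v u); set x := braket u v; ring.
Qed.

(* For [w = 0] the direction is arbitrary. *)
Lemma unit_ket_direction (hd : (2 <= d)%N) w :
  exists a u, [/\ unit_ket u, w = a *: u & normc a ^+ 2 = nsq w].
Proof.
pose i0 : 'I_d := Ordinal (ltnW hd).
have [w0|w0] := eqVneq (nsq w) 0.
  exists 0, (delta_mx i0 0); split; [exact: unit_delta| |].
    rewrite scale0r; apply/matrixP => i j; rewrite ord1 mxE.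
    have /eqP := w0; rewrite psumr_eq0 => [|k _]; last exact: overlap_ge0.
    move=> /allP/(_ i (mem_index_enum _)) /=; rewrite sqrf_eq0 => /eqP.
    move=> /ComplexField.Normc.eq0_normc; rewrite braketE (bigD1 i) //= big1.
      by rewrite mxE !eqxx mulr1 addr0 => /eqP; rewrite conjC_eq0 => /eqP.
    by move=> k ki; rewrite mxE (negbTE ki) mulr0.
  by rewrite w0 ComplexField.Normc.normc0 expr0n.
pose s := Num.sqrt (nsq w); have Ds : nsq w = s ^+ 2 by rewrite sqr_sqrtr ?nsq_ge0.
have s0 : s%:C != 0 :> R[i].
  by rewrite -(rmorph0 (real_complex R)) (inj_eq (@complexI R)) sqrtr_eq0 -ltNge
    lt_def w0 nsq_ge0.
exists s%:C, (s%:C^-1 *: w); split.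
- rewrite /unit_ket braketZ -conj_braket braketZ rmorphM /= -nsqE Ds.
  have cr (x : R) : Num.conj x%:C = x%:C :> R[i] := conjc_real x.
  rewrite fmorphV /= !cr rmorphXn /= expr2.
  by rewrite (mulKf s0) mulVf.
- by rewrite scalerA mulfV // scale1r.
- by rewrite /= expr0n addr0 sqr_sqrtr ?sqr_ge0.
Qed.

End norm_squared.

(** * Moments of the overlap under the Haar measure *)

Section moments.
Local Open Scope sesquilinear_scope.
Context {R : realType} {d : nat} (hd : (2 <= d)%N).
Context (dV : probability (borelSU R d) R) (hdV : haar dV).
Context (ket0 : 'cV[R[i]]_d) (hket0 : unit_ket ket0).
Implicit Types (u v w : 'cV[R[i]]_d).

Local Notation prj w := (fun V : borelSU R d => overlap (estimate ket0 V) w).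
Let i0 : 'I_d := Ordinal (ltnW hd).
Let i1 : 'I_d := Ordinal hd.

Lemma estimate_unit (V : SU R d) : unit_ket (estimate ket0 V).
Proof.
by have [uV _] := set_valP V; exact: unitary_unit_ket.
Qed.

Lemma overlap_estimate_le w (V : SU R d) : overlap (estimate ket0 V) w <= nsq w.
Proof.
have [a [u [uu Dw Da]]] := unit_ket_direction hd w.
rewrite {1}Dw overlapZ Da ler_piMr ?nsq_ge0 //.
exact: overlap_le1 (estimate_unit V) uu.
Qed.

Lemma integrable_overlap w v (a b : nat) :
  dV.-integrable setT (EFin \o (fun V => prj w V ^+ a * prj v V ^+ b)).
Proof.
apply: measurable_bounded_integrable => //.
- by apply: fin_num_fun_lty; exact: fin_num_measure.
- by apply: measurable_funM; apply: measurable_funX; exact: measurable_overlap.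
- exists (nsq w ^+ a * nsq v ^+ b); split; first exact: num_real.
  move=> x ltx V _ /=; apply: (le_trans _ (ltW ltx)).
  have X0 u n : 0 <= prj u V ^+ n by exact/exprn_ge0/overlap_ge0.
  rewrite ger0_norm ?mulr_ge0 ?X0 //; apply: ler_pM; rewrite ?X0 //.
    by rewrite lerXn2r ?nnegrE ?nsq_ge0 ?overlap_ge0 ?overlap_estimate_le.
  by rewrite lerXn2r ?nnegrE ?nsq_ge0 ?overlap_ge0 ?overlap_estimate_le.
Qed.

(** Left invariance replaces [V] by [U V], and the adjoint of [U] moves to [w]. *)
Lemma haar_overlap (U : SU R d) w n :
  \int[dV]_V prj w V ^+ n = \int[dV]_V prj ((\val U)^t* *m w) V ^+ n.
Proof.
rewrite /Rintegral; congr fine.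
(* The moment is an integral against the law of the overlap. The absolute value makes the integrand
   nonnegative on all of [R], as the change of variables requires; invariance makes the two laws
   equal. *)
pose f (x : R) : \bar R := (`|x| ^+ n)%:E.
have mf : measurable_fun setT f.
  by apply/measurable_EFinP; apply: measurable_funX; exact: normr_measurable.
have E v : (\int[dV]_V (prj v V ^+ n)%:E = \int[pushforward dV (prj v)]_x f x)%E.
  rewrite (ge0_integral_pushforward (measurable_overlap ket0 v)) //.
    by apply: eq_integral => V _ /=; rewrite /f ger0_norm ?overlap_ge0.
  by move=> x _; rewrite lee_fin exprn_ge0.
rewrite !E; apply: eq_measure_integral.
- exact: measurable_overlap.
- exact: measurable_overlap.
move=> ? ? A mA _; rewrite /= /pushforward.
rewrite -(@hdV U (prj w @^-1` A)); last first.
  by rewrite -[X in measurable X]setTI; exact: measurable_overlap.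
congr (dV _); apply/funext => V /=; congr (A _).
by rewrite /estimate /= -mulmxA overlap_mul.
Qed.

(** By transitivity on unit kets the choice of basis vector is immaterial, see [moment_unit]. *)
Definition moment n := \int[dV]_V prj (delta_mx i0 0) V ^+ n.

Lemma moment_unit w n : unit_ket w -> \int[dV]_V prj w V ^+ n = moment n.
Proof.
move=> uw; have [U Uw] := @SU_delta _ _ i0 i1 w erefl isT uw.
by rewrite (haar_overlap U) Uw.
Qed.

Lemma moment_overlap w n : \int[dV]_V prj w V ^+ n = moment n * nsq w ^+ n.
Proof.
have [a [u [uu Dw Da]]] := unit_ket_direction hd w.
rewrite -(moment_unit n uu) -Da -(mulrC (_ ^+ n)) -RintegralZl //.
  by rewrite Dw; apply: eq_Rintegral => V _; rewrite overlapZ exprMn.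
have := integrable_overlap u u n 0; apply: eq_integrable => // V _ /=.
by rewrite expr0 mulr1.
Qed.

(** Up to the factor [n.+1], both sides are the sum over the phases [w ^+ j] of the [n]-th moment
    for the ket phi + w^j sqrt(t) psi. The left side expands the overlap inside the integral; the
    right side first evaluates the moment through the squared norm and then averages. *)
Lemma integral_phase (phi psi : 'cV[R[i]]_d) n (t : R) :
  unit_ket phi -> unit_ket psi -> 0 <= t ->
  \sum_(k < n.+1) 'C(n, k)%:R ^+ 2 *
    (\int[dV]_V (prj phi V ^+ (n - k) * prj psi V ^+ k)) * t ^+ k =
  moment n * \sum_(i < n.+1) \sum_(k < n.+1)
    'C(n, i)%:R * 'C(n - i, k)%:R ^+ 2 * (1 - overlap phi psi) ^+ i
      * overlap phi psi ^+ k * t ^+ (i + k).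
Proof.
move=> uphi upsi t0.
(* Order [n.+1] is the least that separates the exponents from 0 to [n]. *)
have [w wL] := @prim_root_exists R[i] n.+1 isT.
pose r : R[i] := (Num.sqrt t)%:C.
have r2 : normc r ^+ 2 = t.
  by rewrite /= expr0n addr0 sqr_sqrtr ?sqr_ge0 // sqr_sqrtr.
have L0 : n.+1%:R != 0 :> R by rewrite pnatr_eq0.
have nr z : normc (r * z) ^+ 2 = t * normc z ^+ 2.
  by rewrite ComplexField.Normc.normcM exprMn r2.
have w1 j : normc (w ^+ j) = 1.
  apply: (@complexI R); have : `|w| = 1 :> R[i].
    by apply/eqP; rewrite -(@pexpr_eq1 _ _ n.+1) // -normrX (prim_expr_order wL) normr1.
  by move=> w1; rewrite -[LHS]/(`|w ^+ j|) normrX w1 expr1n.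
apply: (mulfI L0).
transitivity (\sum_(j < n.+1) \int[dV]_V prj (phi + (w ^+ j * r) *: psi) V ^+ n).
  rewrite -Rintegral_sum; last first.
    move=> j; have := integrable_overlap (phi + (w ^+ j * r) *: psi) phi n 0.
    by apply: eq_integrable => // V _ /=; rewrite expr0 mulr1.
  transitivity (\int[dV]_V \sum_(k < n.+1) (n.+1%:R * ('C(n, k)%:R ^+ 2 * t ^+ k)) *
      (prj phi V ^+ (n - k) * prj psi V ^+ k)).
    rewrite Rintegral_sum; last first.
      move=> k; have := integrable_overlap phi psi (n - k) k.
      move/(integrableZl measurableT (n.+1%:R * ('C(n, k)%:R ^+ 2 * t ^+ k))).
      by apply: eq_integrable.
    rewrite mulr_sumr; apply: eq_bigr => k _.
    rewrite RintegralZl //; last exact: integrable_overlap.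
    by rewrite -!mulrA (mulrC (t ^+ k)).
  apply: eq_Rintegral => V _.
  under [RHS]eq_bigr => j _ do
    rewrite /overlap braketD braketZ -mulrA.
  rewrite (phase_average _ _ (ltnSn n) wL) mulr_sumr; apply: eq_bigr => k _.
  by rewrite nr (exprMn k t) /overlap; ring.
rewrite (eq_bigr (fun j : 'I_n.+1 => moment n *
    (normc (1 + w ^+ j * (r * braket phi psi)) ^+ 2
      + t * (1 - overlap phi psi)) ^+ n)); last first.
  move=> j _; rewrite moment_overlap nsqDZ // ComplexField.Normc.normcM w1 mul1r r2.
  by rewrite -mulrA.
rewrite -mulr_sumr mulrCA; congr (_ * _).
under eq_bigr => j _ do rewrite exprDn.
rewrite exchange_big mulr_sumr; apply: eq_bigr => i _ /=.
have ni : (n - i < n.+1)%N by rewrite ltnS leq_subr.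
transitivity (\sum_(j < n.+1) ('C(n, i)%:R * (t * (1 - overlap phi psi)) ^+ i) *
   (normc (1 + w ^+ j * (r * braket phi psi)) ^+ 2) ^+ (n - i)).
  by apply: eq_bigr => j _; rewrite -mulr_natl -mulrA; congr (_ * _); rewrite mulrC.
rewrite -mulr_sumr (phase_average _ _ ni wL) mulrCA; congr (_ * _).
rewrite mulr_sumr.
pose F k := 'C(n, i)%:R * (t * (1 - overlap phi psi)) ^+ i *
  ('C(n - i, k)%:R ^+ 2 * (normc (1 : R[i]) ^+ 2) ^+ (n - i - k) *
   (normc (r * braket phi psi) ^+ 2) ^+ k).
(* The range of [k] grows from [n - i] to [n]; the added terms carry a vanishing binomial
   coefficient. *)
rewrite (big_ord_widen n.+1 F ni) big_mkcond; apply: eq_bigr => k _ /=.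
rewrite /F ComplexField.Normc.normc1 nr -/(overlap phi psi) !expr1n.
move: (overlap phi psi) => o.
rewrite !exprMn exprD mulr1; case: ifPn => [_|].
  move: (t ^+ i) (t ^+ k) ((1 - o) ^+ i) (o ^+ k) ('C(n, i)%:R : R) ('C(n - i, k)%:R : R).
  by move=> *; ring.
by rewrite -leqNgt => nik; rewrite (bin_small nik) expr0n mulr0 !mul0r.
Qed.

(** The two sides of [integral_phase] are polynomials in [t] that agree for [t >= 0], so their
    coefficients of degree [m] agree. *)
Lemma integral_phase_coef (phi psi : 'cV[R[i]]_d) n m :
  unit_ket phi -> unit_ket psi -> (m <= n)%N ->
  'C(n, m)%:R ^+ 2 * (\int[dV]_V (prj phi V ^+ (n - m) * prj psi V ^+ m)) =
  moment n * \sum_(i < m.+1)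
    'C(n, i)%:R * 'C(n - i, m - i)%:R ^+ 2 * (1 - overlap phi psi) ^+ i
      * overlap phi psi ^+ (m - i).
Proof.
move=> uphi upsi mn.
pose P : {poly R} := \poly_(k < n.+1) ('C(n, k)%:R ^+ 2 *
    (\int[dV]_V (prj phi V ^+ (n - k) * prj psi V ^+ k))).
pose F i k := 'C(n, i)%:R * 'C(n - i, k)%:R ^+ 2 * (1 - overlap phi psi) ^+ i
      * overlap phi psi ^+ k.
pose Q : {poly R} := moment n *: \sum_(i < n.+1) \sum_(k < n.+1) F i k *: 'X^(i + k).
have PQ : P = Q.
  apply: poly_eq_nneg => t t0; rewrite horner_poly (integral_phase n uphi upsi t0).
  rewrite hornerZ horner_sum; congr (_ * _); apply: eq_bigr => i _.
  by rewrite horner_sum; apply: eq_bigr => k _; rewrite hornerZ hornerXn.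
have := congr1 (fun p : {poly R} => p`_m) PQ.
rewrite coef_poly ltnS mn => ->.
rewrite coefZ coef_sum -(sum_antidiagonal F mn); congr (_ * _).
apply: eq_bigr => i _; rewrite coef_sum; apply: eq_bigr => k _.
by rewrite coefZ coefXn.
Qed.

(** The linear coefficient for total degree [M.+1]: with c the overlap, (M + 1)^2 c + (M + 1) (1 -
    c) = (M + 1) (1 + M c). *)
Lemma integral_overlap1 (phi psi : 'cV[R[i]]_d) M :
  unit_ket phi -> unit_ket psi ->
  \int[dV]_V (prj phi V ^+ M * prj psi V) =
  moment M.+1 * (1 + M%:R * overlap phi psi) / M.+1%:R.
Proof.
move=> uphi upsi.
have := @integral_phase_coef phi psi M.+1 1 uphi upsi isT.
rewrite !big_ord_recr big_ord0 /= add0r.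
rewrite !(bin0, bin1, subn0, subSS, subnn, expr0, expr1, expr1n, mulr1, mul1r).
move: (overlap phi psi) (\int[dV]_V _) (moment _) => c I m H.
have M0 : M.+1%:R != 0 :> R by rewrite pnatr_eq0.
apply: (mulfI (expf_neq0 2 M0)); rewrite [LHS]H -natr1 in M0 *.
by field.
Qed.

(** The quadratic coefficient for total degree [M.+2], divided by the square of ['C(M.+2, 2)]. *)
Lemma integral_overlap2 (phi psi : 'cV[R[i]]_d) M :
  unit_ket phi -> unit_ket psi ->
  \int[dV]_V (prj phi V ^+ M * prj psi V ^+ 2) =
  moment M.+2 * (2 + 4 * M%:R * overlap phi psi
     + M%:R * (M%:R - 1) * overlap phi psi ^+ 2) / (M.+1%:R * M.+2%:R).
Proof.
move=> uphi upsi.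
have := @integral_phase_coef phi psi M.+2 2 uphi upsi isT.
rewrite !big_ord_recr big_ord0 /= add0r.
rewrite !(bin0, bin1, binn, subn0, subSS, subnn, expr0, expr1, expr1n, mulr1, mul1r).
move: (overlap phi psi) (\int[dV]_V _) (moment _) => c I m H.
have M1 : M.+1%:R != 0 :> R by rewrite pnatr_eq0.
have M2 : M.+2%:R != 0 :> R by rewrite pnatr_eq0.
have B : 'C(M.+2, 2)%:R = M.+2%:R * M.+1%:R / 2 :> R.
  have := mul_bin_diag M.+2 1; rewrite /= bin1 => /(congr1 (fun n => n%:R : R)).
  by rewrite !natrM => ->; rewrite mulrC mulKf ?pnatr_eq0.
have B0 : 'C(M.+2, 2)%:R != 0 :> R by rewrite pnatr_eq0 -lt0n bin_gt0.
apply: (mulfI (expf_neq0 2 B0)); rewrite H B.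
have E1 : M.+1%:R = M%:R + 1 :> R by rewrite natr1.
have E2 : M.+2%:R = M%:R + 2 :> R by rewrite -addn2 natrD.
rewrite E1 E2 in M1 M2 *.
by field; rewrite M1 M2.
Qed.

Lemma moment0 : moment 0 = 1.
Proof.
rewrite /moment; under eq_Rintegral do rewrite expr0.
rewrite Rintegral_cst // mul1r -[1]/(fine (1 : \bar R)).
by congr fine; exact: probability_setT.
Qed.

(** The overlaps of a unit ket with an orthonormal basis sum to 1. Inserting this sum turns
    [moment M] into mixed moments of first order: [moment M.+1] from [e i0] itself and
    [moment M.+1 / M.+1%:R] from each of the other [d - 1] vectors. *)
Lemma momentS M : moment M.+1 * (M + d)%:R = moment M * M.+1%:R.
Proof.
have d0 : (0 < d)%N by exact: ltnW.
pose e i : 'cV[R[i]]_d := delta_mx i 0.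
have ue i : unit_ket (e i) by exact: unit_delta.
have -> : moment M = \sum_i \int[dV]_V (prj (e i0) V ^+ M * prj (e i) V).
  rewrite -Rintegral_sum; last by move=> i; exact: integrable_overlap _ _ M 1.
  apply: eq_Rintegral => V _; rewrite -mulr_sumr.
  by rewrite (unit_ket_sum (estimate_unit V)) mulr1.
have M0 : M.+1%:R != 0 :> R by rewrite pnatr_eq0.
rewrite (bigD1 i0) //= integral_overlap1 // unit_ket_overlap //.
rewrite (eq_bigr (fun=> moment M.+1 / M.+1%:R)) => [|i ii0]; last first.
  by rewrite integral_overlap1 // overlap_delta 1?eq_sym // mulr0 addr0 mulr1.
rewrite sumr_const cardC1 card_ord mulr1.
have -> : (M + d)%:R = M.+1%:R + d.-1%:R :> R.
  by rewrite -natrD addSnnS prednK.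
rewrite nat1r mulfK // -[(_ / _) *+ _]mulr_natr.
move: (M.+1%:R) (d.-1%:R) (moment _) M0 => x y m x0.
by field.
Qed.

(** This is the normalization of [covariant_density] for a unit [phi]. The recursion [momentS]
    matches (M + d) C(M + d - 1, d - 1) = (M + 1) C(M + d, d - 1). *)
Lemma moment_bin M : 'C(M + d - 1, d - 1)%:R * moment M = 1.
Proof.
have d0 : (0 < d)%N by exact: ltnW.
elim: M => [|M IHM]; first by rewrite add0n binn moment0 mulr1.
have Md0 : (M + d)%:R != 0 :> R by rewrite pnatr_eq0 addn_eq0 negb_and -!lt0n d0 orbT.
have M0 : M.+1%:R != 0 :> R by rewrite pnatr_eq0.
rewrite -[RHS]IHM; apply: (mulfI M0).
have := mul_bin_down (M + d) (d - 1).
rewrite -subn1 (_ : (M + d - (d - 1) = M.+1)%N); last first.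
  by rewrite subnBA // addnAC addnK addn1.
move/(congr1 (fun n => n%:R : R)); rewrite !natrM.
rewrite (_ : (M.+1 + d - 1 = M + d)%N); last by rewrite addSn subn1.
move=> H; have := momentS M.
move: ('C(_, _)%:R) ('C(_, _)%:R) (moment _) (moment _) ((M + d)%:R : R) (M.+1%:R : R) H.
move=> b b' m m' x y H H'.
by rewrite mulrA -H mulrAC -mulrA (mulrC b') mulrA (mulrC x) H'; ring.
Qed.

End moments.

(** * Mean square error of a binomial frequency *)

Section binomial_mse.
Context {R : realType}.
Implicit Types (p a x : R) (n : nat).

(** The binomial expectation of [f] as a finite sum, meaningful as a polynomial in [p] for every
    real [p]. *)
Definition binsum n p (f : nat -> R) :=
  \sum_(k < n.+1) binomial_pmf n p k * f k.

(** Conditioning on one trial: a success shifts the count by 1, a failure leaves it. For the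
    coefficients this is Pascal's rule. *)
Lemma binsumS n p f :
  binsum n.+1 p f = p * binsum n p (fun k => f k.+1) + (1 - p) * binsum n p f.
Proof.
pose q := 1 - p; pose g k := p ^+ k * q ^+ (n - k) *+ 'C(n, k).
have D k : p ^+ k.+1 * q ^+ (n.+1 - k.+1) *+ 'C(n.+1, k.+1) * f k.+1 =
    p * (g k * f k.+1) + p ^+ k.+1 * q ^+ (n.+1 - k.+1) *+ 'C(n, k.+1) * f k.+1.
  rewrite binS mulrnDr mulrDl addrC; congr (_ + _).
  by rewrite subSS exprS /g [in RHS]mulrA [in RHS]mulrnAr [in RHS]mulrA.
pose h k := p ^+ k.+1 * q ^+ (n.+1 - k.+1) *+ 'C(n, k.+1) * f k.+1.
rewrite /binsum big_ord_recl (eq_bigr (fun k : 'I_n.+1 => p * (g k * f k.+1) + h k)).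
  rewrite big_split /= addrCA -mulr_sumr; congr (_ + _).
  (* The top term has binomial coefficient ['C(n, n.+1)], which is 0. *)
  rewrite big_ord_recr /= /h bin_small // mulr0n mul0r addr0 [in RHS]big_ord_recl mulrDr.
  rewrite /binomial_pmf !bin0 !subn0 exprS -/q !mulr1n; congr (_ + _).
    by rewrite /= -[unstable.onem p]/q expr0 !mul1r mulrA.
  rewrite mulr_sumr; apply: eq_bigr => k _.
  rewrite lift0 subSS -(subnSK (ltn_ord k)) (exprS q) -[unstable.onem p]/q.
  by rewrite (mulrCA (_ ^+ k.+1)) [RHS]mulrA mulrnAr.
by move=> k _; rewrite -D.
Qed.

(** Variance plus squared mean of the shifted count. The shift [a] is kept general because the
    induction replaces it by [1 + a]. *)
Lemma binsum_sqr n p a :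
  binsum n p (fun k => (k%:R + a) ^+ 2) = n%:R * p * (1 - p) + (n%:R * p + a) ^+ 2.
Proof.
elim: n a => [|n IHn] a.
  rewrite /binsum big_ord_recl big_ord0 /binomial_pmf /= !expr0 bin0 addr0 mulr1n.
  by rewrite !mul1r !mul0r !add0r.
rewrite binsumS IHn.
have -> : binsum n p (fun k => (k.+1%:R + a) ^+ 2) =
    binsum n p (fun k => (k%:R + (1 + a)) ^+ 2).
  by apply: eq_bigr => k _; rewrite -natr1 addrA.
by rewrite IHn -natr1; ring.
Qed.

Lemma integral_binomial_mse n p c : (0 < n)%N -> 0 <= p <= 1 ->
  (\int[binomial_prob n p]_k ((k%:R / n%:R - c) ^+ 2)%:E =
   (p * (1 - p) / n%:R + (p - c) ^+ 2)%:E)%E.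
Proof.
move=> n0 /andP [p0 p1].
rewrite (@integral_binomial R n p p0 p1) => [|k]; last by rewrite lee_fin sqr_ge0.
rewrite (eq_bigr (fun k : 'I_n.+1 => (binomial_pmf n p k * (k%:R / n%:R - c) ^+ 2)%:E)) //.
have n0' : n%:R != 0 :> R by rewrite pnatr_eq0 -lt0n.
rewrite sumEFin; congr EFin.
transitivity (binsum n p (fun k => (k%:R + (- (c * n%:R))) ^+ 2) / n%:R ^+ 2).
  rewrite /binsum mulr_suml; apply: eq_bigr => k _; rewrite -mulrA; congr (_ * _).
  by field.
by rewrite binsum_sqr; field.
Qed.

End binomial_mse.

(** * The exact mean square error *)

Definition ep_formula (R : realType) (dr n m c : R) : R :=
  (c ^+ 2 * (dr * n + dr ^+ 2 * n + m - 2 * m * n - m ^+ 2)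
   + c * (- 2 * n - 2 * dr * n - 3 * m + dr * m + 2 * m * n + m ^+ 2)
   + dr - 1 + 2 * n + m)
  / (n * (dr + m) * (1 + dr + m)).

(** Given [V], with p the overlap of the estimate with [psi], the error is c^2 + (1/N - 2c) p + (1 -
    1/N) p^2. Hence only the mixed moments of order 0, 1 and 2 in p enter. *)
Lemma ep_mseE (R : realType) (d : nat) (hd : (2 <= d)%N)
    (dV : probability (borelSU R d) R) (hdV : haar dV)
    (ket0 : 'cV[R[i]]_d) (hket0 : unit_ket ket0)
    (psi phi : 'cV[R[i]]_d) (hpsi : unit_ket psi) (hphi : unit_ket phi)
    (N M : nat) : (1 <= N)%N ->
  ep_mse dV ket0 N M psi phi (overlap psi phi) =
  (ep_formula d%:R N%:R M%:R (overlap psi phi))%:E.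
Proof.
move=> N1; set c := overlap psi phi.
have N0 : N%:R != 0 :> R by rewrite pnatr_eq0 -lt0n.
pose B : R := 'C(M + d - 1, d - 1)%:R.
pose f k V := overlap (estimate ket0 V) phi ^+ M * overlap (estimate ket0 V) psi ^+ k.
have intf k : dV.-integrable setT (EFin \o f k) by exact: integrable_overlap.
pose g V := (B * c ^+ 2) * f 0%N V + (B * (N%:R^-1 - 2 * c)) * f 1%N V +
  (B * (1 - N%:R^-1)) * f 2 V.
have intZ a k : dV.-integrable setT (EFin \o (fun V => a * f k V)).
  by apply: eq_integrable (integrableZl measurableT a (intf k)).
have intD (u v : borelSU R d -> R) : dV.-integrable setT (EFin \o u) ->
    dV.-integrable setT (EFin \o v) -> dV.-integrable setT (EFin \o (fun V => u V + v V)).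
  by move=> iu iv; apply: eq_integrable (integrableD measurableT iu iv).
have intg : dV.-integrable setT (EFin \o g).
  by apply: (intD (fun V => _ + _)); first exact: intD.
transitivity (\int[dV]_V (g V)%:E)%E.
  apply: eq_integral => V _; have uV := estimate_unit hket0 V.
  rewrite integral_binomial_mse ?overlap_ge0 ?overlap_le1 // -EFinM; congr EFin.
  rewrite /g /f /covariant_density -/B expr0.
  move: (overlap _ psi) (overlap _ phi ^+ M) => p x.
  by field.
rewrite (integral_EFin intg).
congr EFin; rewrite /g RintegralD //; last by apply: intD.
rewrite RintegralD // !RintegralZl //.
have -> : \int[dV]_V f 0%N V = moment hd dV ket0 M.
  rewrite -(moment_unit hd hdV ket0 M hphi); apply: eq_Rintegral => V _.
  by rewrite /f expr0 mulr1.
have -> : \int[dV]_V f 1%N V =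
    moment hd dV ket0 M.+1 * (1 + M%:R * c) / M.+1%:R.
  by rewrite /c overlapC -(integral_overlap1 hd hdV hket0).
have -> : \int[dV]_V f 2 V =
    moment hd dV ket0 M.+2 * (2 + 4 * M%:R * c + M%:R * (M%:R - 1) * c ^+ 2)
    / (M.+1%:R * M.+2%:R).
  by rewrite /c overlapC -(integral_overlap2 hd hdV hket0).
have := moment_bin hd hdV hket0 M; rewrite -/B.
have := momentS hd hdV hket0 M; have := momentS hd hdV hket0 M.+1.
move: (moment _ _ _ M) (moment _ _ _ M.+1) (moment _ _ _ M.+2) => m0 m1 m2.
have D0 : d%:R + M%:R != 0 :> R.
  by rewrite -natrD pnatr_eq0 addn_eq0 negb_and -!lt0n (ltnW hd).
have D1 : 1 + d%:R + M%:R != 0 :> R.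
  by rewrite nat1r -natrD pnatr_eq0.
have M1 : M%:R + 1 != 0 :> R by rewrite natr1 pnatr_eq0.
have M2 : M%:R + 2 != 0 :> R by rewrite -natrD addn2 pnatr_eq0.
have E1 : M.+1%:R = M%:R + 1 :> R by rewrite natr1.
have E2 : M.+2%:R = M%:R + 2 :> R by rewrite -addn2 natrD.
rewrite addSn -natr1 natrD E1 E2 /ep_formula.
clear intg; clearbody c B; clear g.
move: (M%:R : R) (d%:R : R) (N%:R : R) B N0 D0 D1 M1 M2 => m dr n B n0 D0 D1 M1 M2.
move=> H2 H1 H0.
have B0 : B != 0 by apply: contra_eq_neq H0 => ->; rewrite mul0r eq_sym oner_neq0.
(* Each moment is [B^-1] times a rational function of [m] and [dr], so the density constant [B]
   cancels. *)
have Em0 : m0 = B^-1 by apply: (mulfI B0); rewrite H0 mulfV.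
have Em1 : m1 = B^-1 * (m + 1) / (dr + m).
  by rewrite -Em0 -H1 (addrC dr) mulfK // addrC.
have Em2 : m2 = B^-1 * (m + 1) * (m + 2) / ((dr + m) * (1 + dr + m)).
  have D1' : m + dr + 1 != 0 by rewrite -addrA addrC (addrC dr).
  apply: (mulIf D1'); rewrite H2 Em1; field.
  by rewrite B0 D1 D0.
rewrite Em0 Em1 Em2; field.
by rewrite ?n0 ?B0 ?D0 ?D1 ?M1 ?M2.
Qed.

(** * The two limits *)

Section limits.
Context {R : realType}.

Lemma cvg_natV : (n%:R^-1 : R) @[n --> \oo] --> (0 : R).
Proof. by rewrite -cvg_shiftS; exact: cvg_harmonic. Qed.

(** Serves both limits: a rational function is continuous where its denominator does not vanish, and
    the inverse parameter tends to 0. *)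
Lemma cvg_horner_ratio (I : Type) (F : set_system I) (FF : Filter F)
    (p q : {poly R}) (y : I -> R) :
  q.[0] != 0 -> y x @[x --> F] --> (0 : R) ->
  (p.[y x] / q.[y x]) @[x --> F] --> (p.[0] / q.[0]).
Proof.
move=> q0 y0.
have ch (r : {poly R}) : r.[y x] @[x --> F] --> r.[0].
  apply: (@cvg_comp _ _ _ y (horner r) F (nbhs (0 : R)) (nbhs r.[0]) y0).
  exact: continuous_horner.
by apply: cvgM; [exact: ch|apply: cvgV => //; exact: ch].
Qed.

Lemma equiv_cvg_ratio (f g : nat -> R) :
  (forall i, g i != 0) -> (f i / g i) @[i --> \oo] --> (1 : R) -> f ~_\oo g.
Proof.
move=> g0 fg; apply/eqaddoP => e e0.
move/cvgrPdist_le: fg => /(_ e e0); apply: filterS => i fgi.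
have -> : (f - g) i = (f i / g i - 1) * g i by rewrite mulrBl divfK // mul1r.
by rewrite normrM ler_wpM2r // distrC.
Qed.

(* In terms of [y = 1 / m]. *)
Lemma ep_formula_cvg (dr n c : R) : n != 0 ->
  ep_formula dr n M%:R c @[M --> \oo] --> (c * (1 - c) / n).
Proof.
move=> n0.
(* Numerator and denominator of [ep_formula], each divided by M^2. *)
pose p : {poly R} := (c ^+ 2 * (dr * n + dr ^+ 2 * n) - c * (2 * n + 2 * dr * n) + dr - 1 + 2 * n)%:P * 'X^2
  + (c ^+ 2 * (1 - 2 * n) + c * (- 3 + dr + 2 * n) + 1)%:P * 'X + (c - c ^+ 2)%:P.
pose q : {poly R} := n%:P * (dr%:P * 'X + 1) * ((1 + dr)%:P * 'X + 1).
have q0 : q.[0] = n by rewrite /q !hornerE; ring.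
have p0 : p.[0] = c * (1 - c) by rewrite /p !hornerE /=; ring.
rewrite -{2}q0 -p0.
have q0' : q.[0] != 0 by rewrite q0.
apply: cvg_trans (@cvg_horner_ratio _ \oo _ p q _ q0' cvg_natV).
(* Division by M^2 requires M > 0, so equality with the ratio is claimed only eventually. *)
apply: near_eq_cvg; near=> M.
have M0 : (M%:R : R) != 0 by rewrite pnatr_eq0 -lt0n; near: M; exact: nbhs_infty_gt.
rewrite /ep_formula /p /q !hornerE /=.
move: (M%:R : R) M0 => m m0.
have -> : n * (dr * m^-1 + 1) * ((1 + dr) * m^-1 + 1) =
   n * (dr + m) * (1 + dr + m) / m ^+ 2 by field.
set a := (X in X / _ = _); set b := (X in _ = X / _).
have -> : a = b / m ^+ 2 by rewrite /a /b; field.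
by rewrite invf_div mulrA divfK // expf_neq0.
Unshelve. all: by end_near. Qed.

(* In terms of [y = 1 / (m + n)], with [m = (1 / y + delta) / 2] and
   [n = (1 / y - delta) / 2]. *)
Lemma ep_formula_equiv (dr c : R) (N M : nat -> nat) (delta : int) :
  0 < dr -> 0 < c < 1 ->
  (forall i, (1 <= N i)%N /\ (1 <= M i)%N /\ (M i)%:Z - (N i)%:Z = delta) ->
  (M i + N i)%N @[i --> \oo] --> \oo ->
  (fun i => ep_formula dr (N i)%:R (M i)%:R c)
    ~_\oo (fun i => 6 * c * (1 - c) / (M i + N i)%:R).
Proof.
move=> dr0 /andP [c0 c1] NM MNoo.
have S0 i : (M i + N i)%:R != 0 :> R.
  by rewrite pnatr_eq0 addn_eq0 negb_and -!lt0n; have [-> _] := NM i; rewrite orbT.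
have cc0 : 6 * c * (1 - c) != 0.
  by rewrite !mulf_neq0 ?pnatr_eq0 ?gt_eqF ?subr_gt0.
apply: equiv_cvg_ratio => [i|].
  by rewrite mulf_neq0 // invr_eq0.
pose e : R := delta%:~R.
(* At y = 1 / (m + n) these take the values m / (m + n) and n / (m + n), since m - n = delta. *)
pose m1 : {poly R} := 2^-1%:P * (1 + e%:P * 'X).
pose n1 : {poly R} := 2^-1%:P * (1 - e%:P * 'X).
(* With s = m + n and y = 1 / s, [p] is the numerator of [ep_formula] over s^2 and [q] its
   denominator times 6 c (1 - c) / s^3, so their ratio is the quotient of the two sequences. *)
pose p : {poly R} := (c ^+ 2)%:P * (dr%:P * n1 * 'X + (dr ^+ 2)%:P * n1 * 'X + m1 * 'X
    - 2%:P * m1 * n1 - m1 * m1)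
  + c%:P * (- 2%:P * n1 * 'X - (2 * dr)%:P * n1 * 'X - 3%:P * m1 * 'X + dr%:P * m1 * 'X
     + 2%:P * m1 * n1 + m1 * m1)
  + (dr - 1)%:P * 'X * 'X + 2%:P * n1 * 'X + m1 * 'X.
pose q : {poly R} := (6 * c * (1 - c))%:P * n1 * (dr%:P * 'X + m1) * ((1 + dr)%:P * 'X + m1).
(* At 0 both [m1] and [n1] are 1/2. The numerator keeps (2 m n + m^2) c (1 - c), which gives 3/4,
   and the denominator n m^2 gives 1/8; this is the source of the constant 6. *)
have p0 : p.[0] = 3 / 4 * (c * (1 - c)) by rewrite /p /m1 /n1 !hornerE /=; field.
have q0 : q.[0] = 3 / 4 * (c * (1 - c)) by rewrite /q /m1 /n1 !hornerE /=; field.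
have q0' : q.[0] != 0.
  by rewrite q0 !mulf_neq0 ?invr_eq0 ?pnatr_eq0 ?gt_eqF ?subr_gt0.
have yoo : (M i + N i)%:R^-1 @[i --> \oo] --> (0 : R).
  exact: (@cvg_comp _ _ _ (fun i => (M i + N i)%N) (fun k => k%:R^-1 : R)
    _ _ _ MNoo cvg_natV).
have pq1 : p.[0] / q.[0] = 1 by rewrite p0 -q0 divff.
have H := @cvg_horner_ratio _ \oo eventually_filter p q _ q0' yoo.
rewrite pq1 in H; apply: cvg_trans H.
apply: near_eq_cvg; apply: nearW => i.
have := S0 i; have [Ni [Mi De]] := NM i.
have {}De : e = (M i)%:R - (N i)%:R by rewrite /e -De rmorphB.
have n0 : (0 : R) < (N i)%:R by rewrite ltr0n.
have m0 : (0 : R) < (M i)%:R by rewrite ltr0n.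
rewrite natrD; set m := (M i)%:R; set n := (N i)%:R => s0.
have m1E : m1.[(m + n)^-1] = m / (m + n).
  by rewrite /m1 !hornerE /= De -/m -/n; field.
have n1E : n1.[(m + n)^-1] = n / (m + n).
  by rewrite /n1 !hornerE /= De -/m -/n; field.
(* From here on only the two values just computed are used. *)
clearbody m1 n1.
have D0 : dr + m != 0 by rewrite gt_eqF ?addr_gt0.
have D1 : 1 + dr + m != 0 by rewrite gt_eqF ?addr_gt0.
have n0' : n != 0 by rewrite gt_eqF.
have qE : q.[(m + n)^-1] =
    6 * c * (1 - c) / (m + n) * (n * (dr + m) * (1 + dr + m)) / (m + n) ^+ 2.
  by rewrite /q !(hornerM, hornerD, hornerC, hornerX) m1E n1E; field.
rewrite qE /ep_formula.
set a := (X in X / _ = _); set b := (X in _ = X / _ / _).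
have -> : a = b / (m + n) ^+ 2.
  rewrite /a /b !(hornerM, hornerD, hornerN, hornerC, hornerX) m1E n1E.
  by field.
have gen (A B C s : R) : s != 0 -> A / s / (B * C / s) = A / C / B.
  by move=> s1; rewrite invf_div mulrA divfK // invfM mulrCA mulrC -mulrA.
by apply: gen; rewrite expf_neq0.
Qed.

End limits.

Theorem mainTheorem7 (R : realType) (d : nat) (hd : (2 <= d)%N)
    (dV : probability (borelSU R d) R) (hdV : haar dV)
    (ket0 : 'cV[R[i]]_d) (hket0 : unit_ket ket0)
    (psi phi : 'cV[R[i]]_d) (hpsi : unit_ket psi) (hphi : unit_ket phi)
    (c : R) (hc : overlap psi phi = c) (c01 : 0 < c < 1) :
  let v_ep (N M : nat) : \bar R := ep_mse dV ket0 N M psi phi c in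
  (forall N M : nat, (1 <= N)%N -> (1 <= M)%N ->
     let dr : R := d%:R in let n : R := N%:R in let m : R := M%:R in
     v_ep N M =
       ((c ^+ 2 * (dr * n + dr ^+ 2 * n + m - 2 * m * n - m ^+ 2)
         + c * (- 2 * n - 2 * dr * n - 3 * m + dr * m + 2 * m * n + m ^+ 2)
         + dr - 1 + 2 * n + m)
        / (n * (dr + m) * (1 + dr + m)))%:E)
  /\ (forall N : nat, (1 <= N)%N ->
        v_ep N M @[M --> \oo] --> (c * (1 - c) / N%:R)%:E)
  /\ (forall (N M : nat -> nat) (delta : int),
        (forall i, (1 <= N i)%N /\ (1 <= M i)%N /\ (M i)%:Z - (N i)%:Z = delta) ->
        (M i + N i)%N @[i --> \oo] --> \oo ->
        (fun i => fine (v_ep (N i) (M i)))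
          ~_\oo (fun i => 6 * c * (1 - c) / (M i + N i)%:R)).
Proof.
move=> v_ep.
have vE N M : (1 <= N)%N -> v_ep N M = (ep_formula d%:R N%:R M%:R c)%:E.
  by move=> N1; rewrite /v_ep -hc; exact: ep_mseE.
split; first by move=> N M N1 _; exact: vE.
split=> [N N1|N M delta NM MNoo].
  under eq_cvg do rewrite vE //.
  by apply: cvg_EFin; [exact: nearW|apply: ep_formula_cvg; rewrite pnatr_eq0 -lt0n].
have -> : (fun i => fine (v_ep (N i) (M i))) =
    (fun i => ep_formula d%:R (N i)%:R (M i)%:R c).
  by apply/funext => i; have [N1 _] := NM i; rewrite vE.
by apply: ep_formula_equiv NM MNoo; rewrite // ltr0n ltnW.
Qed.
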